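(* Let $q\in\kappa$ be generic for $\Gamma$ and let $\Theta=[(\bar V_{i,j},\bar A^{i,j}_{k,l}),\bigcup_{i\in I}\{\bar U_i,\bar W_i\}]$ be a decorated $\mathbb{Q}^2_I$-representation with dual $\Theta^{\#}$. If $\Theta$ is $(\Gamma;q)$-realizable, then the following conditions hold: (1) for any $i\in I$, $\Upsilon_i$ is injective; (2) for any $i,j\in I$, $\bar U_i\subset\ker(\Phi^i_j)$; (3) for any $i,j\in I$, $\mathrm{Im}(\Phi^j_i)\subset\bar W_i$; (4) for any $i\in I$ and $j\ne i$, $\bar U_i\cap\bar V_{i,j}=\{0\}$ in $\bigoplus_{k\ne i}\bar V_{i,k}$; (5) conditions (1)–(4) are satisfied for the dual $\Theta^{\#}$.
   Context: **Setting.** $I$ is a finite set, $\Gamma=[m_{i,j}]_{i,j\in I}$ a Coxeter matrix ($m_{i,i}=1$, $m_{i,j}=m_{j,i}\ge 2$ finite integers for $i\neq j$), $\kappa$ a field; all spaces are finite dimensional over $\kappa$. The numbers $4\cos^2(a\pi/m)$, $m=m_{i,j}$, are regarded as elements of $\kappa$ (i.e. $2+\zeta^a+\zeta^{-a}$ with $\zeta$ a primitive $m$-th root of unity). $q\in\kappa\setminus\{0\}$ is generic if for all $i\ne j$ the dihedral Hecke algebra $H_q(I_{m_{i,j}})$ (generators $\sigma_1,\sigma_2$; $\sigma_1\sigma_2\cdots=\sigma_2\sigma_1\cdots$ with $m_{i,j}$ factors; $(\sigma_k-q)(\sigma_k+1)=0$) is semisimple. Put $\lambda_{m;q}(a)=4\cos^2(a\pi/m)/(q+q^{-1}+2)$.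 **$(m;q)$-couples.** For $f:V\to W$, $g:W\to V$ linear, $(f,g)$ is an $(m;q)$-couple between $V$ and $W$ if $gf$ and $fg$ are diagonalizable with eigenvalues in $\{1\}\cup\{\lambda_{m;q}(a):1\le a\le[\frac{m-1}{2}]\}$ when $m$ is odd; for $m$ even the eigenvalue $0$ is also allowed, and then it is required that $gf(x)=0$ implies $f(x)=0$ and $fg(y)=0$ implies $g(y)=0$. **$H$-representations.** An $H$-representation of type $(\Gamma;q)$ is a family of spaces $V_i$ ($i\in I$) and linear maps $A^i_j:V_i\to V_j$ ($i\ne j$) such that, with $V_{i,j}=\ker(A^j_iA^i_j-\mathrm{id})\subset V_i$: (a) $(A^i_j,A^j_i)$ is an $(m_{i,j};q)$-couple for all $i\neq j$; (b) $A^i_k(x)=A^j_kA^i_j(x)$ for all distinct $i,j,k$ and $x\in V_{i,j}$; (c) $\mathrm{Im}(A^k_j-A^i_jA^k_i)\subset \mathrm{Im}(\mathrm{id}_{V_j}-A^i_jA^j_i)$ for all distinct $i,j,k$. Put $V_{i/j}=\mathrm{Im}(\mathrm{id}_{V_i}-A^j_iA^i_j)$; then $V_i=V_{i,j}\oplus V_{i/j}$; let $p^i_{i,j}:V_i\to V_{i,j}$ be the corresponding projection. $V_{i,j}$ and $V_{j,i}$ are identified through the isomorphism $A^i_j|_{V_{i,j}}$ (inverse $A^j_i|_{V_{j,i}}$). **Decorated $\mathbb{Q}^2_I$-representations.** Let $I^2$ be the set of two-element subsets of $I$. A decorated $\mathbb{Q}^2_I$-representation $\Theta=[(\bar V_{i,j},\bar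 A^{i,j}_{k,l}),\bigcup_{i}\{\bar U_i,\bar W_i\}]$ consists of a space $\bar V_{i,j}=\bar V_{j,i}$ for each $\{i,j\}\in I^2$, a linear map $\bar A^{i,j}_{k,l}:\bar V_{i,j}\to \bar V_{k,l}$ for each ordered pair of different elements $\{i,j\},\{k,l\}$ of $I^2$ (independent of the order of $i,j$ and of $k,l$), and for each $i\in I$ two subspaces $\bar U_i,\bar W_i\subset\bigoplus_{j\ne i}\bar V_{i,j}$. Convention: $\bar A^{i,j}_{i,j}=\mathrm{id}$. **Basic data.** The basic data of an $H$-representation $(V_i,A^i_j)$ is the decorated $\mathbb{Q}^2_I$-representation with spaces $V_{i,j}$ (where $V_{i,j}$ and $V_{j,i}$ are identified through the isomorphism $A^i_j|_{V_{i,j}}:V_{i,j}\to V_{j,i}$), maps $A^{i,j}_{k,l}=p^k_{k,l}\circ A^i_k|_{V_{i,j}}$ (with $A^i_i=\mathrm{id}$; up to the identifications $V_{i,j}\cong V_{j,i}$ and $V_{k,l}\cong V_{l,k}$ this is independent of the choice of $i$ in the first pair and of $k$ in the second), $U_i=\ker\big(\bigoplus_{j\ne i}V_{i,j}\to V_i,\ (x_j)\mapsto\sum_j x_j\big)$ and $W_i=\mathrm{Im}\big(V_i\to\bigoplus_{j\neq i}V_{i,j},\ x\mapsto(p^i_{i,j}(x))_j\big)$. $\Theta$ is $(\Gamma;q)$-realizable if it is (up to isomorphism) the basic data of some $H$-representation of type $(\Gamma;q)$. **Dual.** $\Theta^{\#}=[(\bar V_{i,j}^*,A^{\#\,i,j}_{k,l}),\bigcup_i\{U_i^{\#},W_i^{\#}\}]$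 with $A^{\#\,i,j}_{k,l}=(\bar A^{k,l}_{i,j})^*$, $U_i^{\#}=\bar W_i^{\perp}$, $W_i^{\#}=\bar U_i^{\perp}$, where $\perp$ is taken in $\bigoplus_{j\ne i}\bar V_{i,j}^*$ for the natural pairing with $\bigoplus_{j\ne i}\bar V_{i,j}$. **Associated maps.** $\bar V^0_i=(\bigoplus_{j\neq i}\bar V_{i,j})/\bar U_i$ and $\bar V^0=(\bigoplus_{\{i,j\}\in I^2}\bar V_{i,j})/\sum_{i}\bar U_i$; $\Upsilon_i:\bar V^0_i\to\bar V^0$ is induced by the inclusion $\bigoplus_{j\ne i}\bar V_{i,j}\subset\bigoplus_{\{k,j\}\in I^2}\bar V_{k,j}$; for $i,j\in I$ (possibly equal), $\Phi^i_j:\bigoplus_{k\ne i}\bar V_{i,k}\to\bigoplus_{l\ne j}\bar V_{j,l}$ is $\Phi^i_j(\sum_k x_{i,k})=\sum_{k\ne i}\sum_{l\ne j}\bar A^{i,k}_{j,l}(x_{i,k})$. *)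

(* Defs.v *)
From HB Require Import structures.
From mathcomp Require Import all_boot all_order all_algebra all_field.

Set Implicit Arguments.
Unset Strict Implicit.
Unset Printing Implicit Defensive.

Import GRing.Theory.
Local Open Scope ring_scope.


(** The direct sum of a finite family of vector spaces is the space of dependent
    finite functions; MathComp only has the non-dependent case. *)
Definition dsum (K : fieldType) (J : finType) (V : J -> vectType K) : Type :=
  {dffun forall j : J, V j}.

Section DirectSum.
Import VectorInternalTheory.
Variables (K : fieldType) (J : finType) (V : J -> vectType K).
Implicit Types x y : dsum V.

HB.instance Definition _ := Choice.on (dsum V).

Definition dsum_zero : dsum V := [ffun j => 0 : V j].
Definition dsum_add x y : dsum V := [ffun j => x j + y j : V j].
Definition dsum_opp x : dsum V := [ffun j => - x j : V j].
Definition dsum_scale (a : K) x : dsum V := [ffun j => a *: x j : V j].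

Fact dsum_addA : associative dsum_add.
Proof. by move=> x y z; apply/ffunP=> j; rewrite !ffunE addrA. Qed.
Fact dsum_addC : commutative dsum_add.
Proof. by move=> x y; apply/ffunP=> j; rewrite !ffunE addrC. Qed.
Fact dsum_add0 : left_id dsum_zero dsum_add.
Proof. by move=> x; apply/ffunP=> j; rewrite !ffunE add0r. Qed.
Fact dsum_addN : left_inverse dsum_zero dsum_opp dsum_add.
Proof. by move=> x; apply/ffunP=> j; rewrite !ffunE addNr. Qed.

HB.instance Definition _ := GRing.isZmodule.Build (dsum V)
  dsum_addA dsum_addC dsum_add0 dsum_addN.

Fact dsum_scaleA a b x : dsum_scale a (dsum_scale b x) = dsum_scale (a * b) x.
Proof. by apply/ffunP=> j; rewrite !ffunE scalerA. Qed.
Fact dsum_scale1 : left_id 1 dsum_scale.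
Proof. by move=> x; apply/ffunP=> j; rewrite !ffunE scale1r. Qed.
Fact dsum_scaleDr : right_distributive dsum_scale +%R.
Proof. by move=> a x y; apply/ffunP=> j; rewrite !ffunE scalerDr. Qed.
Fact dsum_scaleDl x : {morph dsum_scale^~ x : a b / a + b}.
Proof. by move=> a b; apply/ffunP=> j; rewrite !ffunE scalerDl. Qed.

HB.instance Definition _ := GRing.Zmodule_isLmodule.Build K (dsum V)
  dsum_scaleA dsum_scale1 dsum_scaleDr dsum_scaleDl.

Lemma dsum0E j : (0 : dsum V) j = 0. Proof. by rewrite ffunE. Qed.
Lemma dsumDE x y j : (x + y) j = x j + y j. Proof. by rewrite ffunE. Qed.
Lemma dsumZE a x j : (a *: x) j = a *: x j. Proof. by rewrite ffunE. Qed.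

Fact dsum_vect_iso : Vector.axiom #|{: {j : J & 'I_(dim (V j))}}| (dsum V).
Proof.
pose T : finType := {j : J & 'I_(dim (V j))}.
pose r (x : dsum V) : 'rV[K]_#|T| :=
  \row_(k < #|T|) let t := @enum_val T predT k in v2r (x (tag t)) 0 (tagged t).
exists r.
  by move=> a x y; apply/rowP=> k; rewrite !mxE /= dsumDE dsumZE linearP !mxE.
pose s (u : 'rV[K]_#|T|) : dsum V :=
  [ffun j => r2v (\row_i u 0 (enum_rank (Tagged _ i : T)))].
exists s => [x|u].
  apply/ffunP=> j; rewrite ffunE -[RHS]v2rK; congr r2v.
  by apply/rowP=> i; rewrite !mxE /= enum_rankK.
apply/rowP=> k; rewrite !mxE /= ffunE r2vK mxE; congr (u 0 _).
by rewrite -[RHS]enum_valK; congr enum_rank; case: (enum_val k).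
Qed.

HB.instance Definition _ := Lmodule_hasFinDim.Build K (dsum V) dsum_vect_iso.

Definition dproj_fun (j : J) x : V j := x j.
Fact dproj_is_linear j : linear (@dproj_fun j).
Proof. by move=> a x y; rewrite /dproj_fun dsumDE dsumZE. Qed.
HB.instance Definition _ j :=
  GRing.isLinear.Build K (dsum V) (V j) *:%R (@dproj_fun j) (@dproj_is_linear j).
Definition dproj (j : J) : 'Hom(dsum V, V j) := linfun (@dproj_fun j).

Definition dinj_fun (j : J) (v : V j) : dsum V :=
  [ffun k => dfwith (fun k => 0 : V k) v k].
Fact dinj_is_linear j : linear (@dinj_fun j).
Proof.
move=> a v w; apply/ffunP=> k; rewrite dsumDE dsumZE !ffunE.
have [<-|jk] := eqVneq j k; first by rewrite !dfwith_in.
by rewrite !dfwith_out // scaler0 addr0.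
Qed.
HB.instance Definition _ j :=
  GRing.isLinear.Build K (V j) (dsum V) *:%R (@dinj_fun j) (@dinj_is_linear j).
Definition dinj (j : J) : 'Hom(V j, dsum V) := linfun (@dinj_fun j).

Lemma dprojE j x : dproj j x = x j. Proof. exact: lfunE. Qed.
Lemma dinjE j v : dinj j v = [ffun k => dfwith (fun k => 0 : V k) v k].
Proof. exact: lfunE. Qed.

End DirectSum.

Definition dmap (K : fieldType) (J : finType) (V W : J -> vectType K)
    (f : forall j, 'Hom(V j, W j)) : 'Hom(dsum V, dsum W) :=
  \sum_j (dinj W j \o f j \o dproj V j)%VF.

(** The quotient of [V] by [U], carried by the library's complement [U^C] of [U].
    [quot_proj U] is the canonical surjection, and [quot_ind f U U'] the map
    induced by [f] when [f @: U <= U']. *)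
Section Quotient.
Variable K : fieldType.
Implicit Types V W : vectType K.

Definition quot V (U : {vspace V}) : vectType K := subvs_of (U^C)%VS.

Definition quot_proj V (U : {vspace V}) : 'Hom(V, quot U) :=
  (linfun (vsproj (U^C)) \o daddv_pi (U^C) U)%VF.

Definition quot_ind V W (f : 'Hom(V, W)) (U : {vspace V}) (U' : {vspace W}) :
    'Hom(quot U, quot U') :=
  (quot_proj U' \o f \o linfun (fun x : quot U => vsval x))%VF.

Lemma quot_projK V (U : {vspace V}) (x : quot U) : quot_proj U (vsval x) = x.
Proof.
rewrite comp_lfunE lfunE /= daddv_pi_id ?vsvalK ?subvsP //.
by rewrite capvC capv_compl.
Qed.

Lemma limg_quot_proj V (U : {vspace V}) : limg (quot_proj U) = fullv.
Proof.
apply/vspaceP=> x; rewrite memvf -[x]quot_projK; apply: memv_img.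
by rewrite memvf.
Qed.

Lemma lker_quot_proj V (U : {vspace V}) : lker (quot_proj U) = U.
Proof.
have dxUC : ((U^C) :&: U = 0)%VS by rewrite capvC capv_compl.
apply/vspaceP=> x; rewrite memv_ker comp_lfunE lfunE /=.
have xE : daddv_pi (U^C) U x + daddv_pi U (U^C) x = x.
  by apply: daddv_pi_add; rewrite // addvC addv_complf memvf.
apply/eqP/idP=> [x0|xU].
  rewrite -xE -[daddv_pi (U^C) U x](vsprojK (memv_pi _ _ _)) x0 raddf0 add0r.
  exact: memv_pi.
rewrite -[in LHS](addrK (daddv_pi U (U^C) x) (daddv_pi (U^C) U x)) xE.
by rewrite daddv_pi_id ?capv_compl // subrr raddf0.
Qed.

Lemma quot_indE V W (f : 'Hom(V, W)) (U : {vspace V}) (U' : {vspace W}) x :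
  (f @: U <= U')%VS -> quot_ind f U U' (quot_proj U x) = quot_proj U' (f x).
Proof.
move=> fU; have -> : quot_ind f U U' (quot_proj U x)
    = quot_proj U' (f (vsval (quot_proj U x))).
  move: (quot_proj U x) => y; rewrite /quot_ind; move: (quot_proj U') => P.
  by rewrite !comp_lfunE lfunE.
apply/eqP; rewrite -subr_eq0 -!linearB -memv_ker lker_quot_proj.
apply/(subvP fU)/memv_img.
have: vsval (quot_proj U x) - x \in lker (quot_proj U).
  by rewrite memv_ker linearB /= quot_projK subrr.
by rewrite lker_quot_proj.
Qed.

End Quotient.

Section Dual.
Variable K : fieldType.

Definition dualv (V : vectType K) : vectType K := 'Hom(V, K^o).

Definition transp_fun (V W : vectType K) (f : 'Hom(V, W)) (xi : dualv W) :
  dualv V := (xi \o f)%VF.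
Fact transp_is_linear V W f : linear (@transp_fun V W f).
Proof.
by move=> a x y; rewrite /transp_fun comp_lfunDl comp_lfunZl.
Qed.
HB.instance Definition _ V W f := GRing.isLinear.Build K (dualv W) (dualv V) *:%R
  (@transp_fun V W f) (@transp_is_linear V W f).
Definition transp (V W : vectType K) (f : 'Hom(V, W)) :
  'Hom(dualv W, dualv V) := linfun (transp_fun f).

Lemma transpE (V W : vectType K) (f : 'Hom(V, W)) xi : transp f xi = (xi \o f)%VF.
Proof. exact: lfunE. Qed.

Section Perp.
Variables (J : finType) (V : J -> vectType K).

Definition dpairing (x : dsum V) (xi : dsum (fun j => dualv (V j))) : K^o :=
  \sum_j xi j (x j).
Fact dpairing_is_linear x : linear (dpairing x).
Proof.
move=> a xi eta; rewrite /dpairing scaler_sumr -big_split; apply: eq_bigr => j _.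
by rewrite dsumDE dsumZE add_lfunE scale_lfunE.
Qed.
HB.instance Definition _ x := GRing.isLinear.Build K
  (dsum (fun j => dualv (V j))) K^o *:%R (dpairing x) (dpairing_is_linear x).

Definition perp (U : {vspace dsum V}) : {vspace dsum (fun j => dualv (V j))} :=
  (\bigcap_(x <- vbasis U) lker (linfun (dpairing x)))%VS.

Lemma dpairing_linearl xi : linear (dpairing^~ xi : dsum V -> K^o).
Proof.
move=> a x y; rewrite /dpairing scaler_sumr -big_split; apply: eq_bigr => j _.
by rewrite dsumDE dsumZE linearP.
Qed.

Lemma memv_perp (U : {vspace dsum V}) xi :
  xi \in perp U <-> (forall x, x \in U -> \sum_j xi j (x j) = 0).
Proof.
have memE (s : seq (dsum V)) :
    (xi \in \bigcap_(x <- s) lker (linfun (dpairing x)))%VS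
    = all (fun x => dpairing x xi == 0) s.
  elim: s => [|x s IHs]; first by rewrite big_nil memvf.
  by rewrite big_cons memv_cap IHs memv_ker lfunE.
rewrite /perp memE; split=> [/allP xi0 x xU|xi0].
  pose g : {linear dsum V -> K^o} := HB.pack (dpairing^~ xi)
    (GRing.isLinear.Build K (dsum V) K^o *:%R _ (dpairing_linearl xi)).
  change (g x = 0); rewrite (coord_vbasis xU) linear_sum big1 // => i _.
  rewrite linearZ /=; have /eqP -> := xi0 _ (memt_nth 0 (vbasis U) (ltn_ord i)).
  by rewrite scaler0.
by apply/allP=> x /vbasis_mem xU; apply/eqP/xi0.
Qed.

End Perp.
End Dual.

Definition diagonalizable_end (K : fieldType) (V : vectType K) (h : 'End(V)) :=
  exists2 X : seq V, basis_of fullv X & {in X, forall x, exists a, h x = a *: x}.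

Lemma diagonalizable_disjoint (K : fieldType) (V : vectType K) (h : 'End(V)) :
  diagonalizable_end h -> (lker (h - \1%VF) :&: limg (\1%VF - h) = 0)%VS.
Proof.
case=> X bX eigX; apply/eqP; rewrite -subv0; apply/subvP=> x.
rewrite memv_cap memv0 memv_ker => /andP[kx /memv_imgP[y _ xE]].
have hX (i : 'I_(size X)) : {a | h X`_i == a *: X`_i}.
  apply: sigW; have [a e] := eigX _ (mem_nth 0 (ltn_ord i)).
  by exists a; rewrite e.
pose a i := projT1 (hX i).
have aE (i : 'I_(size X)) : h X`_i = a i *: X`_i by apply/eqP/(projT2 (hX i)).
have [c yE] : exists c : 'I_(size X) -> K, y = \sum_i c i *: X`_i.
  by exists (fun i => coord (in_tuple X) i y); apply: coord_basis (memvf y).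
have xE2 : x = \sum_i ((1 - a i) * c i) *: X`_i.
  rewrite xE add_lfunE opp_lfunE id_lfunE yE linear_sum -sumrB.
  apply: eq_bigr => i _; rewrite linearZ /= aE scalerA mulrBl mul1r scalerBl.
  by rewrite [c i * _]mulrC.
have kxE : \sum_i ((a i - 1) * ((1 - a i) * c i)) *: X`_i = 0.
  apply: etrans (eqP kx); rewrite add_lfunE opp_lfunE id_lfunE xE2 linear_sum -sumrB.
  apply: eq_bigr => i _.
  by rewrite linearZ /= aE scalerA mulrBl scalerBl mul1r [_ * a i]mulrC.
have /freeP fX := basis_free (X := in_tuple X) bX.
rewrite xE2 big1 // => i _.
have /eqP := fX _ kxE i; rewrite -[a i - 1]opprB mulNr oppr_eq0 mulrA !mulf_eq0.
rewrite orbb => /orP[/eqP->|/eqP->]; first by rewrite mul0r scale0r.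
by rewrite mulr0 scale0r.
Qed.


Definition coxeter_matrix (I : finType) (m : I -> I -> nat) : Prop :=
  (forall i, m i i = 1%N) /\
  (forall i j, i != j -> m i j = m j i /\ (2 <= m i j)%N).

Section Hecke.
Variable K : fieldType.

Definition alternating_prod (A : algType K) (m : nat) (s t : A) : A :=
  \prod_(k < m) (if odd k then t else s).

Definition hecke_relations (m : nat) (q : K) (A : algType K) (s1 s2 : A) : Prop :=
  [/\ alternating_prod m s1 s2 = alternating_prod m s2 s1,
      (s1 - q%:A) * (s1 + 1) = 0 & (s2 - q%:A) * (s2 + 1) = 0].

(** [A], with generators [s1] and [s2], is the unital associative algebra presented
    by the Hecke relations. *)
Definition dihedral_hecke_algebra (m : nat) (q : K) (A : algType K) (s1 s2 : A) :
    Prop :=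
  hecke_relations m q s1 s2 /\
  forall (B : algType K) (t1 t2 : B), hecke_relations m q t1 t2 ->
    exists f : {lrmorphism A -> B}, [/\ f s1 = t1, f s2 = t2 &
      forall g : {lrmorphism A -> B}, g s1 = t1 -> g s2 = t2 -> g =1 f].

Definition left_ideal (A : falgType K) (L : {vspace A}) : Prop :=
  forall a x : A, x \in L -> a * x \in L.

(** The left regular module is semisimple: every submodule is a direct summand. *)
Definition semisimple_algebra (A : falgType K) : Prop :=
  forall L : {vspace A}, left_ideal L ->
    exists L' : {vspace A},
      [/\ left_ideal L', (L + L')%VS = fullv & (L :&: L')%VS = 0%VS].

Definition generic (I : finType) (m : I -> I -> nat) (q : K) : Prop :=
  forall i j, i != j ->
    exists (A : falgType K) (s1 s2 : A),
      dihedral_hecke_algebra (m i j) q s1 s2 /\ semisimple_algebra A.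

(** [c a] is the element 4 cos^2 (a pi / m) of [K], for 1 <= a <= [(m - 1) / 2].
    The root of unity may lie outside [K].  No such [a] exists when [m <= 2]. *)
Definition four_cos2_values (m : nat) (c : nat -> K) : Prop :=
  (2 < m)%N ->
  exists (L : fieldType) (iota : {rmorphism K -> L}) (zeta : L),
    m.-primitive_root zeta /\
    forall a, (0 < a <= m.-1./2)%N -> iota (c a) = 2 + zeta ^+ a + zeta ^- a.

(** [c m a] stands for 4 cos^2 (a pi / m) in [K]. *)
Variable c : nat -> nat -> K.

Definition lambda (m : nat) (q : K) (a : nat) : K := c m a / (q + q^-1 + 2).

Definition couple_eigenvalue (m : nat) (q : K) (x : K) : Prop :=
  [\/ x = 1, exists2 a, (1 <= a <= m.-1./2)%N & x = lambda m q a
    | ~~ odd m /\ x = 0].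

Record couple (m : nat) (q : K) (V W : vectType K)
    (f : 'Hom(V, W)) (g : 'Hom(W, V)) : Prop := Couple {
  couple_diag_l : diagonalizable_end (g \o f)%VF;
  couple_diag_r : diagonalizable_end (f \o g)%VF;
  couple_eig_l : forall x, passmx.leigenvalue (g \o f)%VF x -> couple_eigenvalue m q x;
  couple_eig_r : forall x, passmx.leigenvalue (f \o g)%VF x -> couple_eigenvalue m q x;
  couple_ker_l : ~~ odd m -> forall x, g (f x) = 0 -> f x = 0;
  couple_ker_r : ~~ odd m -> forall y, f (g y) = 0 -> g y = 0 }.


Section VParts.
Variables (I : finType) (V : I -> vectType K) (A : forall i j, 'Hom(V i, V j)).

(** The subspaces V_{i,j} and V_{i/j} of V_i. *)
Definition fixpart (i j : I) : {vspace V i} := lker ((A j i \o A i j)%VF - \1%VF).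
Definition cofixpart (i j : I) : {vspace V i} := limg (\1%VF - (A j i \o A i j)%VF).

Definition fixproj (i j : I) : 'End(V i) := daddv_pi (fixpart i j) (cofixpart i j).

End VParts.

(** [hmap R i j] is A^i_j; the maps A^i_i, which are not part of the data, are set
    to the identity. *)
Record Hrep (I : finType) (m : I -> I -> nat) (q : K) := MkHrep {
  hspace : I -> vectType K;
  hmap : forall i j, 'Hom(hspace i, hspace j);
  hmap_id : forall i, hmap i i = \1%VF;
  hmap_couple : forall i j, i != j -> couple (m i j) q (hmap i j) (hmap j i);
  hmap_fix : forall i j k, i != j -> i != k -> j != k ->
    forall x, x \in fixpart hmap i j -> hmap i k x = hmap j k (hmap i j x);
  hmap_cofix : forall i j k, i != j -> i != k -> j != k ->
    (limg (hmap k j - (hmap i j \o hmap k i)%VF) <= cofixpart hmap j i)%VS }.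

End Hecke.


Section Pairs.
Variable I : finType.

Definition pairs : finType := {e : {set I} | #|e| == 2}.

Definition others (i : I) : finType := {j : I | j != i}.

Fact pair_of_subproof i (j : others i) : #|[set i; val j]| == 2.
Proof. by rewrite cards2 [i == _]eq_sym (valP j). Qed.

Definition pair_of i (j : others i) : pairs := Sub [set i; val j] (pair_of_subproof j).

(** A choice of an ordering ([src e], [dst e]) of each pair. *)
Fact src_subproof (e : pairs) : exists i, i \in val e.
Proof. by apply/card_gt0P; rewrite (eqP (valP e)). Qed.
Definition src (e : pairs) : I := xchoose (src_subproof e).

Fact dst_subproof (e : pairs) : exists j, j \in val e :\ src e.
Proof.
apply/card_gt0P; have := cardsD1 (src e) (val e).
by rewrite (eqP (valP e)) (xchooseP (src_subproof e)) add1n => -[<-].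
Qed.
Definition dst (e : pairs) : I := xchoose (dst_subproof e).

Lemma src_neq_dst e : src e != dst e.
Proof. by have /setD1P[+ _] := xchooseP (dst_subproof e); rewrite eq_sym. Qed.

Lemma pair_src_dst e : val e = [set src e; dst e].
Proof.
apply/esym/eqP; rewrite eqEcard cards2 src_neq_dst (eqP (valP e)) leqnn andbT.
have /setD1P[_ dste] := xchooseP (dst_subproof e).
by apply/subsetP=> i /set2P[] ->; [apply: (xchooseP (src_subproof e)) | apply: dste].
Qed.

End Pairs.

Section Decorated.
Variables (K : fieldType) (I : finType).

Definition star (V : pairs I -> vectType K) (i : I) : vectType K :=
  dsum (fun j : others i => V (pair_of j)).

Record decrep := MkDecrep {
  dspace : pairs I -> vectType K;
  dmor : forall e f, 'Hom(dspace e, dspace f);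
  dmor_id : forall e, dmor e e = \1%VF;
  dU : forall i, {vspace star dspace i};
  dW : forall i, {vspace star dspace i} }.

Definition decrep_iso (D E : decrep) : Prop :=
  exists phi : forall e, 'Hom(dspace D e, dspace E e),
    [/\ forall e, lker (phi e) = 0%VS /\ limg (phi e) = fullv,
        forall e f, (phi f \o dmor D e f)%VF = (dmor E e f \o phi e)%VF,
        forall i, (dmap (fun j : others i => phi (pair_of j)) @: dU D i)%VS = dU E i
      & forall i, (dmap (fun j : others i => phi (pair_of j)) @: dW D i)%VS = dW E i].

Fact dec_dual_id (D : decrep) e : transp (dmor D e e) = \1%VF.
Proof. by apply/lfunP=> xi; rewrite transpE dmor_id comp_lfun1r id_lfunE. Qed.

Definition dec_dual (D : decrep) : decrep :=
  @MkDecrep (fun e => dualv (dspace D e)) (fun e f => transp (dmor D f e))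
    (dec_dual_id D) (fun i => perp (dW D i)) (fun i => perp (dU D i)).

Section BasicData.
Variables (c : nat -> nat -> K) (m : I -> I -> nat) (q : K) (R : Hrep c m q).

(** V_{i,j} = V_{j,i} for e = {i,j} is realized inside V_i with i = [src e].  For
    any i in e, [basic_incl e i] is the identification of this space with the
    subspace V_{i,j} of V_i (the inclusion if i = [src e], since then A^i_i = id),
    and [basic_proj (i := i) j] is p^i_{i,j} followed by its inverse. *)
Definition basic_space (e : pairs I) : vectType K :=
  subvs_of (fixpart (hmap R) (src e) (dst e)).

Definition basic_incl (e : pairs I) (i : I) : 'Hom(basic_space e, hspace R i) :=
  (hmap R (src e) i \o linfun (fun x : basic_space e => vsval x))%VF.

Definition basic_proj (i : I) (j : others i) :
    'Hom(hspace R i, basic_space (pair_of j)) :=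
  (linfun (vsproj (fixpart (hmap R) (src (pair_of j)) (dst (pair_of j))))
     \o hmap R i (src (pair_of j)) \o fixproj (hmap R) i (val j))%VF.

Definition basic_mor (e f : pairs I) : 'Hom(basic_space e, basic_space f) :=
  (linfun (vsproj (fixpart (hmap R) (src f) (dst f)))
     \o fixproj (hmap R) (src f) (dst f) \o basic_incl e (src f))%VF.

Fact basic_mor_id e : basic_mor e e = \1%VF.
Proof.
apply/lfunP=> x; rewrite /basic_mor /basic_incl hmap_id comp_lfun1l id_lfunE.
rewrite 2!comp_lfunE !lfunE /= /fixproj daddv_pi_id ?subvsP ?vsvalK //.
exact/diagonalizable_disjoint/(couple_diag_l (hmap_couple R (src_neq_dst e))).
Qed.

Definition basic_data : decrep := @MkDecrep basic_space basic_mor basic_mor_id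
  (fun i => lker (\sum_(j : others i)
     (basic_incl (pair_of j) i \o dproj (fun j => basic_space (pair_of j)) j)%VF))
  (fun i => limg (\sum_(j : others i)
     (dinj (fun j => basic_space (pair_of j)) j \o basic_proj j)%VF)).

End BasicData.

Definition realizable (c : nat -> nat -> K) (m : I -> I -> nat) (q : K)
    (D : decrep) : Prop :=
  exists R : Hrep c m q, decrep_iso D (basic_data R).

Section Associated.
Variable D : decrep.

Definition star_incl (i : I) : 'Hom(star (dspace D) i, dsum (dspace D)) :=
  \sum_(j : others i)
    (dinj (dspace D) (pair_of j) \o dproj (fun j => dspace D (pair_of j)) j)%VF.

Definition dUsum : {vspace dsum (dspace D)} := (\sum_i star_incl i @: dU D i)%VS.

Definition Upsilon (i : I) : 'Hom(quot (dU D i), quot dUsum) :=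
  quot_ind (star_incl i) (dU D i) dUsum.

Lemma UpsilonE i x :
  Upsilon i (quot_proj (dU D i) x) = quot_proj dUsum (star_incl i x).
Proof.
by apply: quot_indE; apply: (sumv_sup i).
Qed.

Definition Phi (i j : I) : 'Hom(star (dspace D) i, star (dspace D) j) :=
  \sum_(k : others i) \sum_(l : others j)
    (dinj (fun l => dspace D (pair_of l)) l \o dmor D (pair_of k) (pair_of l)
       \o dproj (fun k => dspace D (pair_of k)) k)%VF.

Definition cond1 : Prop := forall i, injective (Upsilon i).
Definition cond2 : Prop := forall i j, (dU D i <= lker (Phi i j))%VS.
Definition cond3 : Prop := forall i j, (limg (Phi j i) <= dW D i)%VS.
Definition cond4 : Prop := forall i (j : others i),
  (dU D i :&: limg (dinj (fun k : others i => dspace D (pair_of k)) j) = 0)%VS.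

End Associated.
End Decorated.

(* Main.v *)
Require Import Defs.
From mathcomp Require Import all_boot all_order all_algebra all_field.
Import GRing.Theory.
Local Open Scope ring_scope.

(** For e = {i, j} and any k, not only k in e, let rincl e k : V_e -> V_k be A^i_k
    on V_{i,j} and rproj e k : V_k -> V_e be p^i_{i,j} A^k_i. By axioms (b) and (c)
    neither depends on the choice of i in e, and A^e_f = rproj f k o rincl e k for
    every k in e or in f. With J_i = sum_j rincl {i,j} i and
    P_i = (rproj {i,j} i)_j one has U_i = ker J_i, W_i = Im P_i and
    Phi^i_j = P_j o (sum_k rincl {i,k} j) = (rproj {j,l} i)_l o J_i, which gives (2)
    and (3); (4) holds since rproj e i o rincl e i = id for i in e. For (1), the map
    sum_e rincl e i : (+)_e V_e -> V_i kills every U_l, because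
    rincl {l,j} i = A^l_i o rincl {l,j} l, and restricts to J_i. Transposition
    exchanges rincl and rproj, J and P, hence (5). *)

Section Realizations.
Local Set Implicit Arguments.
Local Unset Strict Implicit.
Local Unset Printing Implicit Defensive.

Variables (K : fieldType) (I : finType).

(** * Coordinates of maps into and out of direct sums *)

Lemma sum_dinj (J : finType) (V : J -> vectType K) (W : vectType K)
    (f : forall j, 'Hom(V j, W)) j v :
  \sum_k f k (dinj V j v k) = f j v.
Proof.
rewrite (bigD1 j) //= dinjE ffunE dfwith_in big1 ?addr0 // => k kj.
by rewrite ffunE dfwith_out ?linear0 // eq_sym.
Qed.

Lemma dinj_sumE (J : finType) (V : J -> vectType K) (W : vectType K)
    (f : forall j, 'Hom(W, V j)) v j :
  (\sum_k dinj V k (f k v)) j = f j v.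
Proof.
rewrite -dprojE linear_sum (bigD1 j) //= dprojE dinjE ffunE dfwith_in.
rewrite big1 ?addr0 // => k kj.
by rewrite dprojE dinjE ffunE dfwith_out.
Qed.

Lemma dmapE (J : finType) (V W : J -> vectType K)
    (f : forall j, 'Hom(V j, W j)) x j : dmap f x j = f j (x j).
Proof.
rewrite /dmap sum_lfunE.
under eq_bigr do rewrite 2!comp_lfunE dprojE.
by rewrite -dprojE linear_sum (bigD1 j) //= dprojE dinjE ffunE dfwith_in
  big1 ?addr0 // => k kj; rewrite dprojE dinjE ffunE dfwith_out.
Qed.

Implicit Types (D : decrep K I) (e f : pairs I) (i k : I).

Lemma star_inclE D i x :
  star_incl D i x = \sum_(j : others i) dinj (dspace D) (pair_of j) (x j).
Proof.
by rewrite sum_lfunE; apply: eq_bigr => j _; rewrite comp_lfunE dprojE.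
Qed.

Lemma PhiE D i j x (l : others j) :
  Phi D i j x l = \sum_(k : others i) dmor D (pair_of k) (pair_of l) (x k).
Proof.
rewrite /Phi sum_lfunE -dprojE linear_sum; apply: eq_bigr => k _ /=.
rewrite sum_lfunE.
under eq_bigr => h _ do rewrite 2!comp_lfunE dprojE -comp_lfunE.
rewrite dprojE.
under eq_bigr => h _ do rewrite comp_lfunE.
exact: (dinj_sumE (fun h : others j => dmor D (pair_of k) (pair_of h))).
Qed.

(** Weaker than an H-representation: only the identities that survive both transposition
    and transport along an isomorphism of decorated representations. *)
Record realization D := Realization {
  rspace : I -> vectType K;
  rmap : forall i j, 'Hom(rspace i, rspace j);
  rincl : forall e i, 'Hom(dspace D e, rspace i);
  rproj : forall e i, 'Hom(rspace i, dspace D e);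
  rincl_map : forall e i k x, i \in val e ->
    rincl e k x = rmap i k (rincl e i x);
  rproj_map : forall e i k x, i \in val e ->
    rproj e k x = rproj e i (rmap k i x);
  rproj_incl : forall e f i x, i \in val e ->
    dmor D e f x = rproj f i (rincl e i x);
  rspace_U : forall i x,
    x \in dU D i <-> \sum_(j : others i) rincl (pair_of j) i (x j) = 0;
  rspace_W : forall i (y : star (dspace D) i),
    y \in dW D i <-> exists v, forall j : others i, y j = rproj (pair_of j) i v }.
Arguments rincl_map {D} r {e i} k x _.
Arguments rproj_map {D} r {e i k} x _.
Arguments rproj_incl {D} r {e} f {i} x _.
Arguments rspace_U {D} r {i x}.
Arguments rspace_W {D} r {i y}.

Lemma mem_pair_of i (j : others i) : i \in val (pair_of j).
Proof. by rewrite /= set21. Qed.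

(** Axiom [rproj_incl] factors [dmor] through a vertex of the source pair; moving from there to [k]
    with [rproj_map] and absorbing the move with [rincl_map] gives the factorization through a
    vertex of the target pair. *)
Lemma rproj_incl_r D (R : realization D) e f k x : k \in val f ->
  dmor D e f x = rproj R f k (rincl R e k x).
Proof.
move=> kf; rewrite (rproj_incl R f x (xchooseP (src_subproof e))).
by rewrite (rproj_map R _ kf) (rincl_map R k x (xchooseP (src_subproof e))).
Qed.

(** * Conditions (1)-(4) for a realized decorated representation *)

Section Conditions.
Variables (D : decrep K I) (R : realization D).

Lemma realization_cond1 : cond1 D.
Proof.
move=> i.
pose J : 'Hom(dsum (dspace D), rspace R i) :=
  \sum_e (rincl R e i \o dproj (dspace D) e)%VF.
have J_incl l x : J (star_incl D l x)
    = \sum_(j : others l) rincl R (pair_of j) i (x j).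
  rewrite star_inclE linear_sum; apply: eq_bigr => j _ /=.
  rewrite -(sum_dinj (rincl R ^~ i)) sum_lfunE.
  by apply: eq_bigr => e _; rewrite comp_lfunE dprojE.
have JU : (dUsum D <= lker J)%VS.
  apply/subv_sumP=> l _; apply/subvP=> _ /memv_imgP[x xU ->].
  rewrite memv_ker J_incl; apply/eqP.
  under eq_bigr => j _ do rewrite (rincl_map R i (x j) (mem_pair_of j)).
  by rewrite -linear_sum (rspace_U R).1 // linear0.
(* Only the kernel matters, by linearity; [y] is rewritten as the class of its representative
   [vsval y] so that [UpsilonE] applies. *)
apply: raddf_inj => y /=; rewrite -[y]quot_projK UpsilonE => /eqP.
rewrite -memv_ker lker_quot_proj => /(subvP JU); rewrite memv_ker J_incl.
by move=> /eqP/(rspace_U R) xU; apply/eqP; rewrite -memv_ker lker_quot_proj.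
Qed.

Lemma realization_cond2 : cond2 D.
Proof.
move=> i j; apply/subvP=> x /(rspace_U R) xU; rewrite memv_ker; apply/eqP/ffunP=> l.
rewrite PhiE dsum0E.
under eq_bigr => k _ do
  rewrite (rproj_incl R (pair_of l) (x k) (mem_pair_of k)).
by rewrite -linear_sum xU linear0.
Qed.

Lemma realization_cond3 : cond3 D.
Proof.
move=> i j; apply/subvP=> _ /memv_imgP[x _ ->]; apply/(rspace_W R).
(* Every target pair contains [i], whereas the source pairs need not: all summands are carried to
   the space at [i] first, and [rproj_incl_r] is the factorization that fits. *)
exists (\sum_(k : others j) rincl R (pair_of k) i (x k)) => l.
rewrite PhiE linear_sum; apply: eq_bigr => k _.
exact: rproj_incl_r (mem_pair_of l).
Qed.

Lemma realization_cond4 : cond4 D.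
Proof.
move=> i j; apply/eqP; rewrite -subv0; apply/subvP=> x.
rewrite memv_cap memv0 => /andP[/(rspace_U R) xU /memv_imgP[z _ xE]].
move: xU; rewrite xE (sum_dinj (fun k : others i => rincl R (pair_of k) i)) => z0.
have := rproj_incl R (pair_of j) z (mem_pair_of j).
by rewrite z0 dmor_id id_lfunE linear0 => ->; rewrite linear0.
Qed.

End Conditions.

Lemma realization_conds D : realization D -> [/\ cond1 D, cond2 D, cond3 D & cond4 D].
Proof.
move=> R; split; [exact: realization_cond1 R | exact: realization_cond2 R
  | exact: realization_cond3 R | exact: realization_cond4 R].
Qed.

(** * Stability of realizations under duality and isomorphism *)

(** A family of functionals kills the image of P_i exactly when its composite with P_i vanishes, and
    it kills the kernel of J_i exactly when it factors through J_i. *)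
Lemma dual_realization D : realization D -> realization (dec_dual D).
Proof.
move=> R; apply: (@Realization (dec_dual D) (fun i => dualv (rspace R i))
  (fun i j => transp (rmap R j i)) (fun e i => transp (rproj R e i))
  (fun e i => transp (rincl R e i))).
- move=> e i k xi ie; rewrite !transpE; apply/lfunP=> v.
  by rewrite !comp_lfunE (rproj_map R v ie).
- move=> e i k xi ie; rewrite !transpE; apply/lfunP=> v.
  by rewrite !comp_lfunE (rincl_map R _ v ie).
- move=> e f i xi ie; rewrite !transpE; apply/lfunP=> v.
  by rewrite !comp_lfunE (rproj_incl_r R v ie).
- move=> i xi /=; apply: (iff_trans (memv_perp _ _)); split=> [xi0|xi0 y].
    apply/lfunP=> v; rewrite sum_lfunE zero_lfunE.
    (* This is P_i(v), a member of W_i on which [xi] can be tested. *)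
    pose y : star (dspace D) i := \sum_(j : others i)
      dinj (fun j : others i => dspace D (pair_of j)) j (rproj R (pair_of j) i v).
    have yE j : y j = rproj R (pair_of j) i v.
      exact: (dinj_sumE (fun j : others i => rproj R (pair_of j) i)).
    rewrite -[RHS](xi0 y); last by apply/(rspace_W R); exists v.
    by apply: eq_bigr => j _; rewrite transpE comp_lfunE yE.
  case/(rspace_W R)=> v yE; have := congr1 (fun g : 'Hom(_, _) => g v) xi0.
  rewrite sum_lfunE zero_lfunE => {2}<-.
  by apply: eq_bigr => j _; rewrite transpE comp_lfunE yE.
move=> i eta /=; apply: (iff_trans (memv_perp _ _)); split=> [eta0|[v etaE] x].
  pose J : 'Hom(star (dspace D) i, rspace R i) := \sum_(j : others i)
    (rincl R (pair_of j) i \o dproj (fun j : others i => dspace D (pair_of j)) j)%VF.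
  have JE x : J x = \sum_(j : others i) rincl R (pair_of j) i (x j).
    by rewrite sum_lfunE; apply: eq_bigr => j _; rewrite comp_lfunE dprojE.
  pose g : 'Hom(star (dspace D) i, K^o) := \sum_(j : others i)
    (eta j \o dproj (fun j : others i => dspace D (pair_of j)) j)%VF.
  have gE x : g x = \sum_(j : others i) eta j (x j).
    by rewrite sum_lfunE; apply: eq_bigr => j _; rewrite comp_lfunE dprojE.
  (* [J^-1] inverts [J] only on its image, so [J^-1 (J x)] and [x] differ by an element of ker J =
     U_i, where [eta] vanishes. Hence [g \o J^-1] is a functional on the space at [i] through which
     [eta] factors. *)
  have gJ x : g (J^-1%VF (J x)) = g x.
    apply/eqP; rewrite -subr_eq0 -(linearB g) /= gE; apply/eqP/eta0/(rspace_U R).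
    by rewrite -JE linearB /= limg_lfunVK ?subrr ?memv_img ?memvf.
  exists (g \o J^-1)%VF => j; rewrite transpE; apply/lfunP=> z; rewrite 2!comp_lfunE.
  rewrite -(sum_dinj (fun k : others i => rincl R (pair_of k) i)) -JE gJ gE.
  by rewrite (sum_dinj eta).
move=> /(rspace_U R) x0; rewrite -[RHS](linear0 v) -x0 linear_sum.
by apply: eq_bigr => j _; rewrite etaE transpE comp_lfunE.
Qed.

(** The spaces at the vertices are kept; [phi] is composed before [rincl] and its inverse after
    [rproj]. The conclusion is [inhabited] because the isomorphism is only known to exist as a
    proposition. *)
Lemma iso_realization D E : decrep_iso D E -> realization E ->
  inhabited (realization D).
Proof.
move=> [phi [phi_bij phi_mor phiU phiW]] R; split.
have phiK e : cancel (phi e) (phi e)^-1%VF.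
  by have [k0 _] := phi_bij e; apply: lker0_lfunK; apply/eqP.
have phiVK e : cancel (phi e)^-1%VF (phi e).
  by move=> x; rewrite limg_lfunVK // (phi_bij e).2 memvf.
have dmapI i : injective (dmap (fun j : others i => phi (pair_of j))).
  move=> x y xy; apply/ffunP=> j; apply: (can_inj (phiK (pair_of j))).
  by rewrite -!(dmapE (fun j : others i => phi (pair_of j))) xy.
have mem_dmap i (S : {vspace star (dspace D) i}) x :
    (dmap (fun j : others i => phi (pair_of j)) x
      \in dmap (fun j : others i => phi (pair_of j)) @: S)%VS = (x \in S).
  by apply/idP/idP=> [/memv_imgP[y yS /dmapI->] | ] //; apply: memv_img.
apply: (@Realization D (rspace R) (rmap R) (fun e i => rincl R e i \o phi e)%VF
  (fun e i => (phi e)^-1 \o rproj R e i)%VF).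
- by move=> e i k x ie; rewrite !comp_lfunE (rincl_map R k _ ie).
- by move=> e i k x ie; rewrite !comp_lfunE (rproj_map R _ ie).
- move=> e f i x ie; rewrite !comp_lfunE -(rproj_incl R f _ ie).
  by rewrite -[dmor E e f _]comp_lfunE -phi_mor comp_lfunE phiK.
- move=> i x; rewrite -(mem_dmap i) phiU; apply: (iff_trans (rspace_U R)).
  by under eq_bigr => j _ do rewrite dmapE -comp_lfunE.
move=> i y; rewrite -(mem_dmap i) phiW; apply: (iff_trans (rspace_W R)).
split=> -[v yE]; exists v => j.
  by rewrite comp_lfunE -yE dmapE phiK.
by rewrite dmapE yE comp_lfunE phiVK.
Qed.

(** * The basic data of an H-representation has a realization *)

Section BasicData.
Variables (c : nat -> nat -> K) (m : I -> I -> nat) (q : K) (R : Hrep c m q).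
Local Notation A := (hmap R).

Lemma memv_fixpart i j x : (x \in fixpart A i j) = (A j i (A i j x) == x).
Proof. by rewrite memv_ker add_lfunE opp_lfunE id_lfunE comp_lfunE subr_eq0. Qed.

Lemma fixcofix_disjoint i j : i != j -> (fixpart A i j :&: cofixpart A i j = 0)%VS.
Proof.
by move=> ij; apply/diagonalizable_disjoint/(couple_diag_l (hmap_couple R ij)).
Qed.

Lemma fixproj_id i j x : i != j -> x \in fixpart A i j -> fixproj A i j x = x.
Proof. by move=> ij; apply: daddv_pi_id; apply: fixcofix_disjoint. Qed.

(** Rank-nullity for id - A^j_i A^i_j, combined with the disjointness that comes from
    diagonalizability. *)
Lemma fixcofix_full i j : i != j -> (fixpart A i j + cofixpart A i j = fullv)%VS.
Proof.
move=> ij; apply/eqP; rewrite eqEdim subvf (dimv_disjoint_sum (fixcofix_disjoint ij)).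
rewrite -(limg_ker_dim (\1%VF - (A j i \o A i j)%VF) fullv) capfv leq_add2r.
by apply/dimvS/subvP=> x; rewrite !memv_ker -(opprB _ \1%VF) opp_lfunE oppr_eq0.
Qed.

Lemma fixproj0 i j x : i != j -> x \in cofixpart A i j -> fixproj A i j x = 0.
Proof.
move=> ij xC; apply: (addIr (daddv_pi (cofixpart A i j) (fixpart A i j) x)).
rewrite daddv_pi_add ?fixcofix_disjoint ?fixcofix_full ?memvf // add0r.
by rewrite daddv_pi_id // capvC fixcofix_disjoint.
Qed.

Lemma fixproj_eq i j x y : i != j -> x - y \in cofixpart A i j ->
  fixproj A i j x = fixproj A i j y.
Proof. by move=> ij /(fixproj0 ij)/eqP; rewrite linearB subr_eq0 => /eqP. Qed.

Lemma mem_cofixpart i j x : x - A j i (A i j x) \in cofixpart A i j.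
Proof. by rewrite -comp_lfunE -{1}(id_lfunE x) -opp_lfunE -add_lfunE memv_img ?memvf. Qed.

(** A^i_j intertwines A^j_i A^i_j with A^i_j A^j_i, so it sends V_{i,j} into V_{j,i} and V_{i/j}
    into V_{j/i}. *)
Lemma fixproj_hmap i j x : i != j ->
  fixproj A j i (A i j x) = A i j (fixproj A i j x).
Proof.
move=> ij; have ji : j != i by rewrite eq_sym.
have /memv_addP[y yF [z zC ->]] : x \in (fixpart A i j + cofixpart A i j)%VS.
  by rewrite fixcofix_full ?memvf.
rewrite !linearD /= (fixproj_id ij yF) (fixproj0 ij zC) linear0; congr (_ + _).
  by apply: fixproj_id => //; rewrite memv_fixpart; move: yF; rewrite memv_fixpart => /eqP->.
apply: fixproj0 => //; case/memv_imgP: zC => w _ ->.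
by rewrite add_lfunE opp_lfunE id_lfunE comp_lfunE linearB mem_cofixpart.
Qed.

(** Axiom (b), extended to [k] equal to [i] or [j] through the convention A^i_i = id. *)
Lemma hmap_fixpart i j k x : i != j -> x \in fixpart A i j ->
  A i k x = A j k (A i j x).
Proof.
move=> ij xF; have [<-|ik] := eqVneq i k.
  by rewrite hmap_id id_lfunE; move: xF; rewrite memv_fixpart => /eqP->.
have [<-|jk] := eqVneq j k; first by rewrite hmap_id id_lfunE.
exact: hmap_fix.
Qed.

(** Axiom (c) puts the difference of the two arguments in V_{j/i}, which the projection kills; for
    [k = j] the difference is in the image of id - A^i_j A^j_i by its very form. *)
Lemma fixproj_hmap_comp i j k x : i != j ->
  fixproj A j i (A k j x) = fixproj A j i (A i j (A k i x)).
Proof.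
move=> ij; have ji : j != i by rewrite eq_sym.
move: x; have [<-|ik] := eqVneq i k => x; first by rewrite hmap_id id_lfunE.
move: x; have [<-|jk] := eqVneq j k => x.
  by rewrite hmap_id id_lfunE; apply/fixproj_eq/mem_cofixpart.
apply: fixproj_eq => //; apply: (subvP (hmap_cofix R ij ik jk)).
by rewrite -comp_lfunE -opp_lfunE -add_lfunE memv_img ?memvf.
Qed.

(** Reconciles [basic_proj], which projects at [i] and then moves to [src e], with moving first and
    projecting there. For [i = dst e] this is [fixproj_hmap]. *)
Lemma fixproj_src e i j v : val e = [set i; j] -> i != j ->
  A i (src e) (fixproj A i j v) = fixproj A (src e) (dst e) (A i (src e) v).
Proof.
move=> eE ij; have sd := src_neq_dst e.
have /set2P[iE|iE] : i \in [set src e; dst e] by rewrite -pair_src_dst eE set21.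
  subst i; have /set2P[dE|<-] : dst e \in [set src e; j].
  - by rewrite -eE pair_src_dst set22.
  - by rewrite dE eqxx in sd.
  by rewrite hmap_id !id_lfunE.
subst i; have /set2P[sE|<-] : src e \in [set dst e; j].
- by rewrite -eE pair_src_dst set21.
- by rewrite sE eqxx in sd.
by rewrite fixproj_hmap // eq_sym.
Qed.

Lemma basic_realization : realization (basic_data R).
Proof.
(* Moving to [src e] before projecting makes sense for every vertex [i], not only for those in
   [e]. *)
pose prj e i : 'Hom(hspace R i, basic_space R e) :=
  (linfun (vsproj (fixpart A (src e) (dst e)))
     \o fixproj A (src e) (dst e) \o A i (src e))%VF.
have prjE e i v : prj e i v
    = vsproj (fixpart A (src e) (dst e)) (fixproj A (src e) (dst e) (A i (src e) v)).
  by rewrite 2!comp_lfunE lfunE.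
have inclE e i x : basic_incl R e i x = A (src e) i (vsval x).
  by rewrite comp_lfunE lfunE.
have incl_map e i k x : i \in val e ->
    basic_incl R e k x = A i k (basic_incl R e i x).
  rewrite !inclE pair_src_dst => /set2P[]->; first by rewrite hmap_id id_lfunE.
  exact: hmap_fixpart (src_neq_dst e) (subvsP x).
apply: (@Realization (basic_data R) (hspace R) A (basic_incl R) prj).
- exact: incl_map.
- move=> e i k x; rewrite !prjE pair_src_dst => /set2P[]->.
    by rewrite hmap_id id_lfunE.
  by rewrite -fixproj_hmap_comp // eq_sym src_neq_dst.
- move=> e f i x ie; rewrite prjE -incl_map //.
  by rewrite /= 2!comp_lfunE lfunE.
- move=> i x; rewrite memv_ker sum_lfunE.
  under eq_bigr => j _ do rewrite comp_lfunE dprojE.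
  by split=> /eqP.
have prj_basic i (j : others i) v : basic_proj R j v = prj (pair_of j) i v.
  rewrite prjE 2!comp_lfunE lfunE /=; congr vsproj; apply: fixproj_src => //.
  by rewrite eq_sym (valP j).
move=> i y; split=> [/memv_imgP[v _ ->]|[v yE]].
  exists v => j; rewrite -prj_basic sum_lfunE.
  under eq_bigr => k _ do rewrite comp_lfunE.
  exact: (dinj_sumE (fun j : others i => basic_proj R j)).
apply/memv_imgP; exists v; rewrite ?memvf //; apply/ffunP=> j.
rewrite yE -prj_basic sum_lfunE.
under eq_bigr => k _ do rewrite comp_lfunE.
exact/esym/(dinj_sumE (fun j : others i => basic_proj R j)).
Qed.

End BasicData.
End Realizations.

Theorem theorem5p2 (I : finType) (m : I -> I -> nat) (kappa : fieldType)
    (q : kappa) (cos2 : nat -> nat -> kappa) (Theta : decrep kappa I)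
    (Hm : coxeter_matrix m)
    (Hcos2 : forall i j, i != j -> four_cos2_values (m i j) (cos2 (m i j)))
    (q_neq0 : q != 0)
    (q_generic : generic m q)
    (Theta_realizable : realizable cos2 m q Theta) :
  [/\ cond1 Theta, cond2 Theta, cond3 Theta, cond4 Theta
    & [/\ cond1 (dec_dual Theta), cond2 (dec_dual Theta),
          cond3 (dec_dual Theta) & cond4 (dec_dual Theta)]].
Proof.
have [R ThetaR] := Theta_realizable.
have [S] := iso_realization ThetaR (basic_realization R).
have [c1 c2 c3 c4] := realization_conds S.
by split=> //; apply: realization_conds (dual_realization S).
Qed.
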